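(* For all integers $a \ge 1$ and all $x \ge 1$, $$\frac{1}{x} \sum_{n=1}^x |\mathcal{Q}_a[1,n]| = \frac{4}{3}\sqrt{\frac{x}{a}} + O(\log x + a),$$ in which the $O$-constant is independent of $a$ and $x$. That is, there is an absolute constant $C$ such that for all integers $a \ge 1$ and all $x \ge 1$ the absolute value of the difference between the left side and $\frac43\sqrt{x/a}$ is at most $C(\log x + a)$.
   Context: For positive integers $d, n$, one writes $d \preccurlyeq_1 n$ if $d = \lfloor n/k \rfloor$ for some positive integer $k$. For an integer $a \ge 1$, one writes $d \preccurlyeq_a n$ (''$d$ is an $a$-floor quotient of $n$'') if and only if $ad \preccurlyeq_1 an$, i.e. there is a positive integer $k$ with $ad = \lfloor an/k \rfloor$. The initial interval is $\mathcal{Q}_a[1,n] = \{d \in \mathbb{N}^+ : d \preccurlyeq_a n\}$ (every $n$ satisfies $1 \preccurlyeq_a n$), and $|\cdot|$ denotes cardinality. Here $x$ is a real number and the sum $\sum_{n=1}^x$ runs over the integers $n$ with $1 \le n \le x$. *)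

(* Defs.v *)
From HB Require Import structures.
From mathcomp Require Import all_boot all_order all_algebra.
From mathcomp Require Import finmap.
From mathcomp Require Import boolp classical_sets functions cardinality reals.

Set Implicit Arguments.
Unset Strict Implicit.
Unset Printing Implicit Defensive.

Local Open Scope classical_set_scope.

(* [n %/ k] is Euclidean division on [nat], i.e. the floor of n / k. *)
Definition floor_quotient1 (d n : nat) : Prop :=
  exists k : nat, (0 < k)%N /\ d = (n %/ k)%N.

Definition floor_quotient (a d n : nat) : Prop :=
  floor_quotient1 (a * d) (a * n).

(* The interval Q_a[1, n]. *)
Definition initial_interval (a n : nat) : set nat :=
  [set d | (0 < d)%N /\ floor_quotient a d n].

(* [fset_set] is empty on infinite sets; this lemma ensures that
   [card_initial_interval] is the true cardinality. *)
Lemma finite_initial_interval (a n : nat) :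
  (0 < a)%N -> finite_set (initial_interval a n).
Proof.
move=> a0; apply: (sub_finite_set _ (finite_II n.+1)) => d [_ [k [_ e]]].
by rewrite /= ltnS -(leq_pmul2l a0) e leq_div.
Qed.

Definition card_initial_interval (a n : nat) : nat :=
  #|` fset_set (initial_interval a n)|%fset.

(* Main.v *)
Require Import Defs.
From mathcomp Require Import all_boot all_order all_algebra finmap.
From mathcomp Require Import classical_sets cardinality.
From mathcomp Require Import reals exp.
From mathcomp Require Import zify ring lra.

Import Order.TTheory GRing.Theory Num.Theory.

(** Writing n = q d + r with 0 <= r < d, the number d is an a-floor quotient
    of n exactly when a r < q ([floor_quotientP]).  So the sum over n <= x of
    the sizes of the intervals counts the pairs (d, n) with n <= x and
    a (n mod d) < floor (n / d), and it can be summed over n first, with d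
    fixed.

    For fixed d, cut the integers into blocks [k d, (k + 1) d).  The k-th
    block contributes the number of r < d with a r < k, which is
    min (d, k / a) up to 1 ([block_countP]).  With y = x / d, the blocks meeting
    [0, x] are those with k <= y.  The roundings cost at most 1 per block, and
    the last block, which may be truncated, contributes O(y), so the count for d
    is the integral of min (d, t / a) over 0 <= t <= y, with an error O(y)
    ([quotient_count_huber]).  This integral is, up to the factor
    1 / a, the Huber function of y with threshold a d.  Summed over d <= x, the
    errors x / d give O(x log x) by the harmonic sum.

    Let D = sqrt (x / a).  In terms of D, the main term for d is
    a (D^2 - d^2 / 2) for d <= D and a D^4 / (2 d^2) for d > D
    ([huber_profile]).  It decreases with d, so its sum over d is its integral
    over (0, oo) up to the value a D^2 = x at 0 and a tail of size O(x).  The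
    two pieces of the integral are 5/6 a D^3 and 1/2 a D^3, whence the total
    4/3 a D^3 = 4/3 x sqrt (x / a) ([sum_profile_bounds]).

    Both comparisons of a sum with an integral use a primitive that lies on
    one side of its tangents ([huber_convex], [profile_int_concave]); this
    inequality alone gives the two bounds ([sum_antideriv_bounds]). *)

(** * Floor quotients through Euclidean division *)

(** An admissible k satisfies d k <= n < d k + k / a.  If some k works, so does
    every larger k with d k <= n, hence the largest one, k = n %/ d; for it the
    second inequality reads a (n %% d) < n %/ d. *)
Lemma floor_quotientP (a d n : nat) : (0 < a)%N -> (0 < d)%N ->
  floor_quotient a d n <-> (a * (n %% d) < n %/ d)%N.
Proof.
move=> a0 d0; have ad0 : (0 < a * d)%N by rewrite muln_gt0 a0.
have En := divn_eq n d; set q := (n %/ d)%N in En *; set r := (n %% d)%N in En *.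
split=> [[k [k0 adE]] | ltrq].
  have le_adk : (a * d * k <= a * n)%N by rewrite adE leq_divM.
  have lt_an : (a * n < (a * d).+1 * k)%N by rewrite adE -ltn_divLR.
  have le_kq : (k <= q)%N.
    by rewrite /q leq_divRL // mulnC -(leq_pmul2l a0) mulnA.
  nia.
have q0 : (0 < q)%N by apply: leq_ltn_trans ltrq.
exists q; split=> //.
have -> : (a * n = a * d * q + a * r)%N by rewrite En; ring.
by rewrite divnMDl // divn_small // addn0.
Qed.

(** The range of d may go up to any m >= n, since n %/ d = 0 for d > n.  A range
    common to all n <= m is what allows the two summations to be exchanged. *)
Lemma card_initial_intervalE (a n m : nat) : (0 < a)%N -> (n <= m)%N ->
  card_initial_interval a n =
    \sum_(1 <= d < m.+1) (a * (n %% d) < n %/ d)%N.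
Proof.
move=> a0 le_nm; rewrite /card_initial_interval.
pose s := [seq d <- index_iota 1 m.+1 | (a * (n %% d) < n %/ d)%N].
have -> : \sum_(1 <= d < m.+1) (a * (n %% d) < n %/ d)%N = size s.
  by rewrite -sum1_size big_filter [RHS]big_mkcond.
apply/perm_size/uniq_perm.
- exact: fset_uniq.
- by rewrite filter_uniq // iota_uniq.
move=> d; rewrite in_fset_set; last exact: finite_initial_interval.
rewrite mem_filter mem_index_iota.
apply/idP/idP => [/set_mem [d0 /(floor_quotientP _ _ _ a0 d0) ltrq] | ].
  rewrite ltrq d0 ltnS (leq_trans _ le_nm) //.
  by have := leq_ltn_trans (leq0n _) ltrq; rewrite divn_gt0.
by move=> /and3P[ltrq d0 _]; apply/mem_set; split=> //; apply/floor_quotientP.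
Qed.

(** * The integers n having a fixed number d as floor quotient *)

(** The size of the k-th block: the number of n in [k d, (k + 1) d) that have d
    as an a-floor quotient. *)
Definition block_count (a d k : nat) : nat := \sum_(0 <= r < d) (a * r < k)%N.

(** The count is exactly min (d, ceil (k / a)); multiplying by a keeps the
    bounds in the integers. *)
Lemma block_countP (a d k : nat) :
  (minn (a * d) k <= a * block_count a d k <= minn (a * d) k + a)%N.
Proof.
(* Either all r < d are counted, or the count has already reached k / a. *)
suff : (a * block_count a d k <= k + a)%N /\
  (block_count a d k = d \/
   (block_count a d k < d)%N /\ (k <= a * block_count a d k)%N) by nia.
elim: d => [|d]; first by rewrite /block_count big_nil; lia.
rewrite /block_count big_nat_recr //= => -[].
by case: (ltnP (a * d) k) => /= ? ?; nia.
Qed.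

Definition quotient_count (a d m : nat) : nat :=
  \sum_(0 <= n < m) (a * (n %% d) < n %/ d)%N.

Lemma quotient_count_blocks (a d K : nat) : (0 < d)%N ->
  quotient_count a d (K * d) = \sum_(0 <= k < K) block_count a d k.
Proof.
move=> d0; elim: K => [|K IH]; first by rewrite /quotient_count !big_nil.
rewrite big_nat_recr //= -IH /quotient_count mulSn addnC.
rewrite (@big_cat_nat _ _ _ (K * d)) ?leq_addr //=; congr addn.
rewrite -{1}[(K * d)%N]add0n big_addn addKn; apply: eq_big_nat => r /andP[_ ltrd].
by rewrite addnC modnMDl divnMDl // divn_small // modn_small // addn0.
Qed.

Lemma leq_quotient_count (a d m m' : nat) : (m <= m')%N ->
  (quotient_count a d m <= quotient_count a d m')%N.
Proof.
by move=> le_mm'; rewrite /quotient_count (big_cat_nat _ le_mm') ?leq_addr.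
Qed.

Local Open Scope ring_scope.

Section Comparison.
Context {R : realFieldType}.
Implicit Types e s t D : R.

(** * Sums against primitives *)

(** The hypothesis says that F lies below its tangents, f giving the slopes.
    The tangents at k and at k + 1 enclose the increment of F from k to k + 1
    between f (k + 1) and f k. *)
Lemma sum_antideriv_bounds (F f : R -> R) (m n : nat) : (m <= n)%N ->
  (forall s t, 0 <= s -> 0 <= t -> F t - F s <= f s * (t - s)) ->
  \sum_(m.+1 <= k < n.+1) f k%:R <= F n%:R - F m%:R <=
  \sum_(m <= k < n) f k%:R.
Proof.
move=> le_mn conc; rewrite big_add1 /= -(telescope_sumr (fun k => F k%:R) le_mn).
apply/andP; split; apply: ler_sum_nat => k _.
  have := conc k.+1%:R k%:R (ler0n _ _) (ler0n _ _); rewrite -natr1; lra.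
have := conc k%:R k.+1%:R (ler0n _ _) (ler0n _ _); rewrite -natr1; lra.
Qed.

(** For e >= 0, the integral of min (e, u) over 0 <= u <= t. *)
Definition huber e t : R := if t <= e then t ^+ 2 / 2 else e * t - e ^+ 2 / 2.

(** The Huber function is convex, with derivative min (e, s) at s. *)
Lemma huber_convex e s t : Num.min e s * (t - s) <= huber e t - huber e s.
Proof.
rewrite /huber minElt -subr_ge0.
case: (lerP s e) (lerP t e) => [se|es] [te|et].
- by rewrite (_ : _ - _ = (t - s) ^+ 2 / 2) ?divr_ge0 ?sqr_ge0 //; field.
- rewrite (_ : _ - _ = (e - s) ^+ 2 / 2 + (e - s) * (t - e)); last by field.
  by rewrite addr_ge0 ?mulr_ge0 ?divr_ge0 ?sqr_ge0 //; lra.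
- by rewrite (_ : _ - _ = (t - e) ^+ 2 / 2) ?divr_ge0 ?sqr_ge0 //; field.
- by rewrite (_ : _ - _ = 0) //; field.
Qed.

(** The sum over the blocks is compared with the value of the Huber function at
    K = floor (x / d), and K is then replaced by x / d.  After multiplication by
    a, the last, possibly truncated, block costs at most K + a, and the rounding
    of each of the others costs a. *)
Lemma quotient_count_huber (a d : nat) (x : R) : (0 < a)%N -> (0 < d)%N ->
  d%:R <= x -> forall X, X%:R <= x < X.+1%:R ->
  `| a%:R * (quotient_count a d X.+1)%:R - huber (a * d)%:R (x / d%:R) |
     <= 3 * a%:R * (x / d%:R).
Proof.
move=> a0 d0 dx X /andP[Xx xX].
have leDX : (d <= X)%N by rewrite -ltnS -(ltr_nat R) (le_lt_trans dx).
set K := (X %/ d)%N; set y := x / d%:R; set e : R := (a * d)%:R.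
have K0 : (0 < K)%N by rewrite divn_gt0.
have dR : 0 < d%:R :> R by rewrite ltr0n.
have aR : 1 <= a%:R :> R by rewrite ler1n.
have Ky : K%:R <= y.
  by rewrite ler_pdivlMr // -natrM (le_trans _ Xx) // ler_nat leq_divM.
have yK : y <= K%:R + 1.
  by rewrite ler_pdivrMr // natr1 -natrM (le_trans (ltW xX)) // ler_nat ltn_ceil.
have K1 : 1 <= K%:R :> R by rewrite ler1n.
pose m (k : R) := Num.min e k.
have blk k : m k%:R <= a%:R * (block_count a d k)%:R <= m k%:R + a%:R.
  have /andP[lo hi] := block_countP a d k.
  by rewrite /m /e -natrM -natr_min -natrD !ler_nat lo.
have lo : (quotient_count a d (K * d) <= quotient_count a d X.+1)%N.
  by apply: leq_quotient_count; apply: leqW; apply: leq_divM.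
have hi : (quotient_count a d X.+1 <= quotient_count a d (K.+1 * d))%N.
  by apply: leq_quotient_count; apply: ltn_ceil.
rewrite !quotient_count_blocks // in lo hi.
have lo' : \sum_(0 <= k < K) m k%:R <= a%:R * (quotient_count a d X.+1)%:R.
  apply: (@le_trans _ _ (a%:R * (\sum_(0 <= k < K) block_count a d k)%:R)).
    by rewrite natr_sum mulr_sumr; apply: ler_sum_nat => k _; case/andP: (blk k).
  by rewrite ler_wpM2l // ler_nat.
have hi' : a%:R * (quotient_count a d X.+1)%:R <=
    \sum_(0 <= k < K) m k%:R + m K%:R + K.+1%:R * a%:R.
  apply: (@le_trans _ _ (a%:R * (\sum_(0 <= k < K.+1) block_count a d k)%:R)).
    by rewrite ler_wpM2l // ler_nat.
  rewrite -big_nat_recr //= natr_sum mulr_sumr.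
  have -> : K.+1%:R * a%:R = \sum_(0 <= k < K.+1) a%:R :> R.
    by rewrite sumr_const_nat subn0 mulr_natl.
  by rewrite -big_split; apply: ler_sum_nat => k _; case/andP: (blk k).
have /andP[S1 S2] := @sum_antideriv_bounds (fun t => - huber e t) (fun t => - m t)
   0 K (leq0n _) ltac:(move=> s t _ _; have := huber_convex e s t; rewrite /m; lra).
rewrite !sumrN big_add1 /= in S1 S2.
have H0 : huber e 0 = 0 by rewrite /huber ler0n expr0n mul0r.
have mK : m K%:R <= K%:R by rewrite /m ge_min lexx orbT.
have my : m y <= y by rewrite /m ge_min lexx orbT.
have m0 : 0 <= m K%:R by rewrite /m le_min !ler0n.
have S3 : \sum_(0 <= k < K) m k.+1%:R = \sum_(0 <= k < K) m k%:R + m K%:R.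
  rewrite -big_nat_recr //= [RHS]big_nat_recl //=.
  by rewrite [m _](_ : _ = 0) ?add0r // /m minElt ltNge ler0n.
have C1 := huber_convex e K%:R y; have C2 := huber_convex e y K%:R.
rewrite -/(m _) in C1; rewrite -/(m _) in C2.
rewrite S3 !H0 in S1 S2.
rewrite -natr1 in hi'.
have Z1 : 0 <= m K%:R * (y - K%:R) by rewrite mulr_ge0 // subr_ge0.
have Z2 : m y * (y - K%:R) <= y by nra.
rewrite ler_norml; apply/andP; split; nra.
Qed.

(** * The main term as a function of d *)

(** With u = t / D, this is D^2 times 1 - u^2 / 2 for u <= 1 and 1 / (2 u^2) for
    u > 1; multiplied by a, it is the main term of the count for d = t. *)
Definition profile D t : R :=
  if t <= D then D ^+ 2 - t ^+ 2 / 2 else D ^+ 4 / (2 * t ^+ 2).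

(** The primitive of the profile that vanishes at 0.  The constant 4/3 D^3 makes
    the two branches agree at D, and is therefore the integral over (0, oo). *)
Definition profile_int D t : R :=
  if t <= D then D ^+ 2 * t - t ^+ 3 / 6
  else 4 / 3 * D ^+ 3 - D ^+ 4 / (2 * t).

Lemma profile_ge0 D t : 0 <= t -> 0 <= profile D t.
Proof.
move=> t0; rewrite /profile; case: (lerP t D) => tD; first by nra.
by apply: divr_ge0; [exact: exprn_even_ge0 | rewrite mulr_ge0 ?sqr_ge0].
Qed.

Lemma huber_profile a D t : 0 < a -> 0 < D -> 0 < t ->
  huber (a * t) (a * D ^+ 2 / t) = a ^+ 2 * profile D t.
Proof.
move=> a0 D0 t0; rewrite /huber /profile.
have -> : (a * D ^+ 2 / t <= a * t) = (D <= t).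
  rewrite ler_pdivrMr // -mulrA ler_pM2l // -expr2.
  by rewrite ler_pXn2r ?nnegrE ?(ltW D0) ?(ltW t0).
by case: (ltrgtP D t) => [_|_|->]; field; apply: lt0r_neq0.
Qed.

(** The profile decreases, so its primitive is concave.  In each of the four
    cases the defect is written as an explicit nonnegative expression. *)
Lemma profile_int_concave D s t : 0 < D -> 0 <= s -> 0 <= t ->
  profile_int D t - profile_int D s <= profile D s * (t - s).
Proof.
move=> D0 s0 t0; rewrite /profile_int /profile -subr_ge0.
case: (lerP t D) (lerP s D) => [tD|Dt] [sD|Ds].
- rewrite (_ : _ - _ = (t - s) ^+ 2 * (t + 2 * s) / 6); last by field.
  by rewrite divr_ge0 // mulr_ge0 ?sqr_ge0 //; lra.
- have s1 : s != 0 by rewrite gt_eqF // (lt_trans D0 Ds).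
  (* The point u <= D conjugate to s: it makes the defect polynomial. *)
  have [u u0 [uD uE]] : exists2 u, 0 <= u & u <= D /\ D ^+ 2 = u * s.
    exists (D ^+ 2 / s); first by rewrite divr_ge0 ?sqr_ge0.
    by split; [rewrite ler_pdivrMr; nra | rewrite divfK].
  have D4 : D ^+ 4 = u ^+ 2 * s ^+ 2 by rewrite -exprMn -uE -exprM.
  have -> : D ^+ 4 / (2 * s ^+ 2) * (t - s) -
      (D ^+ 2 * t - t ^+ 3 / 6 - (4 / 3 * D ^+ 3 - D ^+ 4 / (2 * s))) =
      (D - t) ^+ 2 * (2 * D + t) / 6 + (D - u) * (D ^+ 2 - (u + D) * t / 2).
    rewrite D4; have -> : u ^+ 2 * s ^+ 2 / (2 * s ^+ 2) = u ^+ 2 / 2 by field.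
    have -> : u ^+ 2 * s ^+ 2 / (2 * s) = u * D ^+ 2 / 2 by rewrite uE; field.
    have -> : u ^+ 2 / 2 * (t - s) = u ^+ 2 * t / 2 - u * D ^+ 2 / 2.
      by rewrite uE; field.
    by field.
  apply: addr_ge0; first by rewrite divr_ge0 // mulr_ge0 ?sqr_ge0 //; lra.
  by apply: mulr_ge0; nra.
- have t1 : t != 0 by rewrite gt_eqF // (lt_trans D0 Dt).
  have t2 : 0 < t by rewrite (lt_trans D0 Dt).
  have -> : (D ^+ 2 - s ^+ 2 / 2) * (t - s) -
      (4 / 3 * D ^+ 3 - D ^+ 4 / (2 * t) - (D ^+ 2 * s - s ^+ 3 / 6)) =
    D ^+ 2 * (t - D) ^+ 2 / (2 * t) +
      ((D - s) ^+ 2 * (D + 2 * s) / 6 + (D ^+ 2 - s ^+ 2) * (t - D) / 2).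
    by field.
  apply: addr_ge0.
    rewrite divr_ge0 ?(mulr_ge0 (sqr_ge0 D)) ?sqr_ge0 //; lra.
  apply: addr_ge0; rewrite divr_ge0 // mulr_ge0 ?sqr_ge0 //; nra.
- have [sp tp] : 0 < s /\ 0 < t by split; lra.
  have [s1 t1] : s != 0 /\ t != 0 by rewrite !gt_eqF.
  have -> : D ^+ 4 / (2 * s ^+ 2) * (t - s) -
      (4 / 3 * D ^+ 3 - D ^+ 4 / (2 * t) - (4 / 3 * D ^+ 3 - D ^+ 4 / (2 * s))) =
      D ^+ 4 * (t - s) ^+ 2 / (2 * s ^+ 2 * t) by field; rewrite s1 t1.
  apply: divr_ge0; first by rewrite mulr_ge0 ?sqr_ge0 ?exprn_ge0 ?ltW.
  by rewrite !mulr_ge0 ?ltW.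
Qed.

(** The tail D^4 / (2 t) beyond t > D is at most D^2 as soon as t >= D^2 / 2;
    if t <= D, the hypotheses force D <= 2 and the bound is crude. *)
Lemma profile_int_bounds D t : 0 < D -> 1 <= t -> D ^+ 2 <= t + 1 ->
  4 / 3 * D ^+ 3 - 3 * D ^+ 2 <= profile_int D t <= 4 / 3 * D ^+ 3.
Proof.
move=> D0 t1 D2t; rewrite /profile_int; case: (lerP t D) => tD; apply/andP; split.
- have D2 : D <= 2 by nra.
  have : D ^+ 3 <= 2 * D ^+ 2 by rewrite exprS ler_wpM2r ?sqr_ge0.
  have : t ^+ 3 <= D ^+ 2 * t.
    by rewrite exprSr ler_wpM2r ?ler_pXn2r ?nnegrE //; lra.
  have : 0 <= D ^+ 2 * t by rewrite mulr_ge0 ?sqr_ge0 //; lra.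
  have := sqr_ge0 D; lra.
- by nra.
- by rewrite lerD2l lerN2 ler_pdivrMr; [nra | lra].
- by rewrite lerBlDr lerDl divr_ge0 ?exprn_ge0 ?mulr_ge0 //; lra.
Qed.

Lemma sum_profile_bounds D n : 0 < D -> (0 < n)%N -> D ^+ 2 <= n%:R + 1 ->
  4 / 3 * D ^+ 3 - 4 * D ^+ 2 <= \sum_(1 <= d < n.+1) profile D d%:R <=
    4 / 3 * D ^+ 3.
Proof.
move=> D0 n0 D2n; have n1 : 1 <= n%:R :> R by rewrite ler1n.
have /andP[lo hi] := @profile_int_bounds D n%:R D0 n1 D2n.
have /andP[T1 T2] := @sum_antideriv_bounds (profile_int D) (profile D) 0 n
  (leq0n _) (fun s t => @profile_int_concave D s t D0).
have P0 : profile_int D 0 = 0 by rewrite /profile_int ltW //; ring.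
have p0 : profile D 0 = D ^+ 2 by rewrite /profile ltW //; ring.
have pn : 0 <= profile D n%:R by apply: profile_ge0; lra.
have shift : \sum_(0 <= k < n) profile D k%:R <=
    D ^+ 2 + \sum_(1 <= d < n.+1) profile D d%:R.
  by rewrite big_ltn // p0 lerD2l [leRHS]big_nat_recr //= lerDl.
by rewrite P0 subr0 in T1 T2; apply/andP; split; lra.
Qed.

End Comparison.

(** * The average *)

(** The induction step is ln (1 - 1 / (n + 1)) <= - 1 / (n + 1). *)
Lemma harmonic_le (R : realType) (n : nat) : (0 < n)%N ->
  \sum_(1 <= k < n.+1) (k%:R : R)^-1 <= 1 + ln n%:R.
Proof.
elim: n => // -[|n] IH _; first by rewrite big_nat1 invr1 ln1 addr0.
rewrite big_nat_recr //=; apply: le_trans (lerD (IH isT) (lexx _)) _.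
rewrite -addrA lerD2l -lerBrDr.
have n0 : 0 < n.+2%:R :> R by rewrite ltr0n.
have -> : n.+1%:R = n.+2%:R * (1 + - n.+2%:R^-1) :> R.
  by rewrite mulrDr mulr1 mulrN mulfV ?gt_eqF // -[n.+2%:R]natr1 addrK.
have v1 : n.+2%:R^-1 < 1 :> R by rewrite invf_lt1 // ltr1n.
have v2 : 0 < 1 + - n.+2%:R^-1 :> R by rewrite subr_gt0.
by rewrite lnM ?posrE // lerD2l le_ln1Dx // ltrN2.
Qed.

Theorem theorem1p7 (R : realType) :
  exists C : R, forall (a : nat) (x : R), (1 <= a)%N -> 1 <= x ->
    `| x^-1 * (\sum_(1 <= n < (Num.truncn x).+1) (card_initial_interval a n)%:R)
       - 4 / 3 * Num.sqrt (x / a%:R) | <= C * (ln x + a%:R).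
Proof.
exists 7 => a x a0 x1.
have x0 : 0 < x by lra.
have aR : 1 <= a%:R :> R by rewrite ler1n.
set X := Num.truncn x; set D := Num.sqrt _.
have D0 : 0 < D by rewrite sqrtr_gt0 divr_gt0 //; lra.
have DE : x = a%:R * D ^+ 2
  by rewrite sqr_sqrtr ?divr_ge0 ?(ltW x0) // mulrC divfK // gt_eqF //; lra.
have /andP[Xx xX] : X%:R <= x < X.+1%:R := truncn_itv (ltW x0).
have X1 : (0 < X)%N by rewrite truncn_gt0.
have XR : 1 <= X%:R :> R by rewrite ler1n.
have -> : \sum_(1 <= n < X.+1) (card_initial_interval a n)%:R =
    \sum_(1 <= d < X.+1) (quotient_count a d X.+1)%:R :> R.
  rewrite -!natr_sum; congr (_%:R).
  under eq_big_nat => n /andP[_ nX] do rewrite (@card_initial_intervalE a n X) //.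
  rewrite exchange_big_nat; apply: eq_bigr => d _.
  by rewrite /quotient_count [RHS]big_ltn //= mod0n div0n muln0.
set S := \sum_(_ <= _ < _) _.
(* Both sides of the estimate for d carry a factor a, cancelled here. *)
have errd d : (1 <= d < X.+1)%N ->
  `|(quotient_count a d X.+1)%:R - a%:R * profile D d%:R| <= 3 * x * d%:R^-1.
  move=> /andP[d0 dX].
  have dR : 0 < d%:R :> R by rewrite ltr0n.
  have dx : d%:R <= x by rewrite (le_trans _ Xx) // ler_nat.
  have := @quotient_count_huber R a d x a0 d0 dx X _; rewrite Xx xX => /(_ isT).
  rewrite [in huber _ _]DE natrM huber_profile //; last lra.
  rewrite (_ : _ - _ =
    a%:R * ((quotient_count a d X.+1)%:R - a%:R * profile D d%:R)); last by ring.
  rewrite normrM ger0_norm //.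
  rewrite (_ : _ * (x / _) = a%:R * (3 * x * d%:R^-1)); last by ring.
  by rewrite ler_pM2l //; lra.
have err : `|S - a%:R * \sum_(1 <= d < X.+1) profile D d%:R| <= 3 * x * (1 + ln x).
  rewrite mulr_sumr -sumrB; apply: le_trans (ler_norm_sum _ _ _) _.
  apply: le_trans (ler_sum_nat errd) _; rewrite -mulr_sumr ler_pM2l; last lra.
  apply: le_trans (harmonic_le _ _ X1) _; rewrite lerD2l ler_ln ?posrE //; lra.
have D2X : D ^+ 2 <= X%:R + 1.
  by apply: le_trans (_ : D ^+ 2 <= x) _; [nra | rewrite natr1 ltW].
have /andP[lo hi] := sum_profile_bounds D X D0 X1 D2X.
have main : `|S - 4 / 3 * x * D| <= 3 * x * (1 + ln x) + 4 * x.
  move: err; rewrite !ler_norml => /andP[e1 e2].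
  have xD : a%:R * (4 / 3 * D ^+ 3) = 4 / 3 * x * D by rewrite DE; ring.
  have T4 : a%:R * \sum_(1 <= d < X.+1) profile D d%:R <= 4 / 3 * x * D.
    by rewrite -xD ler_pM2l //; lra.
  have T5 : 4 / 3 * x * D - 4 * x <= a%:R * \sum_(1 <= d < X.+1) profile D d%:R.
    have -> : 4 * x = a%:R * (4 * D ^+ 2) by rewrite DE; ring.
    by rewrite -xD -mulrBr ler_pM2l //; lra.
  by apply/andP; split; lra.
rewrite (_ : _ - _ = x^-1 * (S - 4 / 3 * x * D)); last by field; lra.
rewrite normrM gtr0_norm ?invr_gt0 // ler_pdivrMl //.
apply: le_trans main _.
have lx : 0 <= ln x by rewrite ln_ge0.
rewrite [leLHS](_ : _ = x * (3 * ln x + 7)); last by ring.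
by rewrite ler_pM2l //; lra.
Qed.
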